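(* Let $k$ be a field, and let $E$ and $F$ be finite graphs with no sinks. Then the adjacency matrices of $E$ and $F$ are shift equivalent if and only if the following condition holds: there exist a $kE^0$--$kF^0$-bimodule $M$, a $kF^0$--$kE^0$-bimodule $N$, and a positive integer $n$ for which there are bimodule isomorphisms $$(kE^1)^{\otimes n} \cong M \otimes_{kF^0} N, \qquad (kF^1)^{\otimes n} \cong N \otimes_{kE^0} M,$$ $$kE^1 \otimes_{kE^0} M \cong M \otimes_{kF^0} kF^1, \qquad kF^1 \otimes_{kF^0} N \cong N \otimes_{kE^0} kE^1$$ (the first and fourth lists being isomorphisms of bimodules over the evident algebras: respectively $kE^0$--$kE^0$, $kF^0$--$kF^0$, $kE^0$--$kF^0$, and $kF^0$--$kE^0$).
   Context: A (directed) graph $E=(E^0,E^1,s,r)$ consists of a vertex set $E^0$, an edge set $E^1$, and source and range maps $s,r:E^1\to E^0$. It is finite if $E^0$ and $E^1$ are finite; a vertex $v$ is a sink if $s^{-1}(v)=\emptyset$. The adjacency matrix $A_E$ is the $E^0\times E^0$ matrix with $A_E(v,w)=\#\{e\in E^1: s(e)=v,\ r(e)=w\}$. Two square matrices $A$ and $B$ (not necessarily of the same size) with nonnegative integer entries are shift equivalent if there exist a positive integer $n$ and rectangular matrices $R$ and $S$ with nonnegative integer entries such that $A^n=RS$, $B^n=SR$, $AR=RB$, and $BS=SA$. For a set $V$, $kV$ is the $k$-vector space with basis $V$, made into a $k$-algebra by $vw=\delta_{v,w}v$ for $v,w\in V$. For a graph $E$, $kE^1$ is the $k$-vector space with basis $E^1$,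 made into a $kE^0$--$kE^0$-bimodule by $v\cdot e=e$ if $s(e)=v$ and $0$ otherwise, and $e\cdot w=e$ if $r(e)=w$ and $0$ otherwise. $(kE^1)^{\otimes n}$ denotes the $n$-fold tensor product of $kE^1$ with itself over $kE^0$ (and similarly for $F$ over $kF^0$). Bimodules over $k$-algebras are unital, and the left and right actions of $k$ agree. *)

(* Defs.v *)
From HB Require Import structures.
From mathcomp Require Import all_boot all_order all_algebra.
From mathcomp Require Import boolp freeg.

Set Implicit Arguments.
Unset Strict Implicit.
Unset Printing Implicit Defensive.

Import GRing.Theory.
Local Open Scope ring_scope.
Local Open Scope quotient_scope.

Record finGraph := FinGraph {
  vert : finType;
  edge : finType;
  src : edge -> vert;
  rng : edge -> vert }.

Definition sink (E : finGraph) (v : vert E) : bool :=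
  [set e | src e == v] == set0.

Definition no_sinks (E : finGraph) : Prop := forall v : vert E, ~~ sink v.

Definition adjacency (E : finGraph) : 'M[nat]_#|vert E| :=
  \matrix_(i, j)
    #|[set e : edge E | (src e == enum_val i) && (rng e == enum_val j)]|.

Definition shift_equivalent (p q : nat) (A : 'M[nat]_p) (B : 'M[nat]_q) : Prop :=
  exists (n : nat) (R : 'M[nat]_(p, q)) (S : 'M[nat]_(q, p)),
    (0 < n)%N /\
    [/\ A ^+ n = R *m S, B ^+ n = S *m R, A *m R = R *m B & B *m S = S *m A].

(* The algebra kV is {ffun V -> k^o} with its pointwise product, the basis
   element v being the indicator function of v; see fun_baseM. Writing k^o
   (k as a module over itself) gives {ffun V -> k^o} its k-module structure.
   V may be empty, in which case kV is the zero ring, so kV is not an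
   algType. *)
Definition fun_base (k : fieldType) (V : finType) (v : V) : {ffun V -> k^o} :=
  [ffun w => (w == v)%:R].

Lemma fun_baseM (k : fieldType) (V : finType) (v w : V) :
  fun_base k v * fun_base k w = (v == w)%:R *: fun_base k v.
Proof.
apply/ffunP=> u; rewrite !ffunE; case: (eqVneq v w) => [<-|vw].
  by rewrite scale1r; case: eqP; rewrite ?mulr1 ?mulr0.
rewrite scale0r; case: (eqVneq u v) => [->|_]; last by rewrite mul0r.
by rewrite (negPf vw) mulr0.
Qed.

(* Unital kV-kW-bimodules. The fields lactZ and ractZ say that the actions of
   k through kV and through kW are both the scalar multiplication of the
   carrier; in particular they agree. *)
Record bimod (k : fieldType) (V W : finType) := Bimod {
  carrier :> lmodType k;
  lact : {ffun V -> k^o} -> carrier -> carrier;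
  ract : carrier -> {ffun W -> k^o} -> carrier;
  lactDl : forall a b x, lact (a + b) x = lact a x + lact b x;
  lactDr : forall a x y, lact a (x + y) = lact a x + lact a y;
  lactZ : forall (c : k) a x, lact (c *: a) x = c *: lact a x;
  lact1 : forall x, lact 1 x = x;
  lactM : forall a b x, lact (a * b) x = lact a (lact b x);
  ractDl : forall x y b, ract (x + y) b = ract x b + ract y b;
  ractDr : forall x a b, ract x (a + b) = ract x a + ract x b;
  ractZ : forall (c : k) x b, ract x (c *: b) = c *: ract x b;
  ract1 : forall x, ract x 1 = x;
  ractM : forall x a b, ract x (a * b) = ract (ract x a) b;
  lractA : forall a x b, ract (lact a x) b = lact a (ract x b) }.

Definition bimod_iso (k : fieldType) (V W : finType) (M N : bimod k V W) : Prop :=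
  exists f : {linear M -> N},
    [/\ bijective f,
        forall a x, f (lact a x) = lact a (f x)
      & forall x b, f (ract x b) = ract (f x) b].

Section BimodTheory.
Variables (k : fieldType) (V W : finType) (M : bimod k V W).

Lemma lact_scaler (a : {ffun V -> k^o}) (c : k) (x : M) :
  lact a (c *: x) = c *: lact a x.
Proof.
have cE (y : M) : c *: y = lact (c *: (1 : {ffun V -> k^o})) y by rewrite lactZ lact1.
rewrite !cE -!lactM; congr lact; apply/ffunP=> v; rewrite !ffunE.
by rewrite /GRing.scale /= mulr1 mulrC.
Qed.

Lemma ract_scaler (c : k) (x : M) (b : {ffun W -> k^o}) :
  ract (c *: x) b = c *: ract x b.
Proof.
have cE (y : M) : c *: y = ract y (c *: (1 : {ffun W -> k^o})) by rewrite ractZ ract1.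
rewrite !cE -!ractM; congr ract; apply/ffunP=> v; rewrite !ffunE.
by rewrite /GRing.scale /= mulr1 mulrC.
Qed.

End BimodTheory.

Section RegularBimod.
Variables (k : fieldType) (V : finType).

Definition regular_bimod : bimod k V V.
Proof.
pose A := {ffun V -> k^o}.
refine (@Bimod k V V A (fun a x => a * x) (fun x b => x * b)
          _ _ _ _ _ _ _ _ _ _ _).
- by move=> a b x; rewrite mulrDl.
- by move=> a x y; rewrite mulrDr.
- by move=> c a x; apply/ffunP=> v; rewrite !ffunE /= scalerAl.
- by move=> x; rewrite mul1r.
- by move=> a b x; rewrite mulrA.
- by move=> x y b; rewrite mulrDl.
- by move=> x a b; rewrite mulrDr.
- by move=> c x b; apply/ffunP=> v; rewrite !ffunE /= scalerAr.
- by move=> x; rewrite mulr1.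
- by move=> x a b; rewrite mulrA.
- by move=> a x b; rewrite mulrA.
Defined.

End RegularBimod.

(* kE^1 is {ffun edge E -> k^o}; see edge_lactE and edge_ractE for the
   actions on basis elements. *)
Section EdgeBimod.
Variables (k : fieldType) (E : finGraph).

Definition edge_lact (a : {ffun vert E -> k^o}) (x : {ffun edge E -> k^o}) :
  {ffun edge E -> k^o} := [ffun e => a (src e) * x e].

Definition edge_ract (x : {ffun edge E -> k^o}) (b : {ffun vert E -> k^o}) :
  {ffun edge E -> k^o} := [ffun e => x e * b (rng e)].

Definition edge_bimod : bimod k (vert E) (vert E).
Proof.
refine (@Bimod k (vert E) (vert E) {ffun edge E -> k^o} edge_lact edge_ract
          _ _ _ _ _ _ _ _ _ _ _).
- by move=> a b x; apply/ffunP=> e; rewrite !ffunE mulrDl.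
- by move=> a x y; apply/ffunP=> e; rewrite !ffunE mulrDr.
- by move=> c a x; apply/ffunP=> e; rewrite !ffunE /= scalerAl.
- by move=> x; apply/ffunP=> e; rewrite !ffunE mul1r.
- by move=> a b x; apply/ffunP=> e; rewrite !ffunE mulrA.
- by move=> x y b; apply/ffunP=> e; rewrite !ffunE mulrDl.
- by move=> x a b; apply/ffunP=> e; rewrite !ffunE mulrDr.
- by move=> c x b; apply/ffunP=> e; rewrite !ffunE /= scalerAr.
- by move=> x; apply/ffunP=> e; rewrite !ffunE mulr1.
- by move=> x a b; apply/ffunP=> e; rewrite !ffunE mulrA.
- by move=> a x b; apply/ffunP=> e; rewrite !ffunE mulrA.
Defined.

Lemma edge_lactE (v : vert E) (e : edge E) :
  lact (fun_base k v) (fun_base k e : edge_bimod) =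
    if src e == v then fun_base k e else 0.
Proof.
apply/ffunP=> f; rewrite !ffunE; case: (eqVneq f e) => [->|fe].
  by case: ifP => _; rewrite !ffunE ?eqxx ?mulr1.
by case: ifP => _; rewrite !ffunE ?(negPf fe) ?mulr0.
Qed.

Lemma edge_ractE (w : vert E) (e : edge E) :
  ract (fun_base k e : edge_bimod) (fun_base k w) =
    if rng e == w then fun_base k e else 0.
Proof.
apply/ffunP=> f; rewrite !ffunE; case: (eqVneq f e) => [->|fe].
  by case: ifP => _; rewrite !ffunE ?eqxx ?mul1r.
by case: ifP => _; rewrite !ffunE ?(negPf fe) ?mul0r.
Qed.

End EdgeBimod.

Lemma fglift_scale (k : fieldType) (K : choiceType) (L : lmodType k)
    (f : K -> L) (c : k) (D : {freeg K / k}) :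
  fglift f (c *: D) = c *: fglift f D.
Proof.
have FS (g : K -> k) : fglift f (\sum_(x <- dom D) << g x *g x >>) =
                       \sum_(x <- dom D) g x *: f x.
  pose F : {additive {freeg K / k} -> L} :=
    HB.pack_for {additive {freeg K / k} -> L} (fglift f)
      (GRing.isZmodMorphism.Build {freeg K / k} L (fglift f)
         (lift_is_additive f)).
  rewrite -[LHS]/(F _) raddf_sum; apply: eq_bigr => x _; exact: liftU.
have -> : c *: D = fgscale c D by [].
rewrite FS -[in RHS](freeg_sumE D) FS scaler_sumr.
by apply: eq_bigr => x _; rewrite scalerA.
Qed.

HB.instance Definition _ (k : fieldType) (K : choiceType) (L : lmodType k)
    (f : K -> L) :=
  GRing.isZmodMorphism.Build {freeg K / k} L (fglift f) (lift_is_additive f).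
HB.instance Definition _ (k : fieldType) (K : choiceType) (L : lmodType k)
    (f : K -> L) :=
  GRing.isScalable.Build k {freeg K / k} L *:%R (fglift f) (fglift_scale f).

Lemma freeg_linear_eq (k : fieldType) (K : choiceType) (L : lmodType k)
    (f g : {linear {freeg K / k} -> L}) :
  (forall x : K, f << x >> = g << x >>) -> f =1 g.
Proof.
move=> fg D; rewrite -[D]freeg_sumE !raddf_sum; apply: eq_bigr => x _ /=.
have -> : << coeff x D *g x >> = coeff x D *: << x >> :> {freeg K / k}.
  by apply/eqP/freeg_eqP => y; rewrite coeffZ !coeffU mul1r.
by rewrite !linearZ /= fg.
Qed.

Section Tensor.
Variables (k : fieldType) (U V W : finType) (M : bimod k U V) (N : bimod k V W).

Local Notation free := {freeg (M * N)%type / k}.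

(* The k-subspace spanned by the relators of the tensor product of M and N
   over kV. k-homogeneity in the second variable follows from the first
   variable and balancedness, since k acts through kV; see pure_scaler. *)
Inductive tensor_null : free -> Prop :=
| TensorDl x x' y : tensor_null (<< (x + x', y) >> - << (x, y) >> - << (x', y) >>)
| TensorDr x y y' : tensor_null (<< (x, y + y') >> - << (x, y) >> - << (x, y') >>)
| TensorZ (c : k) x y : tensor_null (<< (c *: x, y) >> - c *: << (x, y) >>)
| TensorBal x b y : tensor_null (<< (ract x b, y) >> - << (x, lact b y) >>)
| TensorNull0 : tensor_null 0
| TensorNullD s t : tensor_null s -> tensor_null t -> tensor_null (s + t)
| TensorNullZ (c : k) s : tensor_null s -> tensor_null (c *: s).

Definition tensor_nullb : {pred free} := fun s => `[< tensor_null s >].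

Lemma tensor_nullP s : reflect (tensor_null s) (s \in tensor_nullb).
Proof. exact: asboolP. Qed.

Lemma tensor_null_zmod_closed : zmod_closed tensor_nullb.
Proof.
split=> [|s t /tensor_nullP s0 /tensor_nullP t0]; apply/tensor_nullP.
  exact: TensorNull0.
by rewrite -scaleN1r; apply: TensorNullD => //; apply: TensorNullZ.
Qed.

HB.instance Definition _ :=
  GRing.isZmodClosed.Build free tensor_nullb tensor_null_zmod_closed.

Definition tensor_sort := Quotient.quot tensor_nullb.
HB.instance Definition _ := GRing.Zmodule.on tensor_sort.

Definition tensor_pi (s : free) : tensor_sort := \pi_(tensor_sort) s.

Lemma tensor_piP s t : tensor_null (s - t) <-> tensor_pi s = tensor_pi t.
Proof.
have E : (s - t \in tensor_nullb) = (tensor_pi s == tensor_pi t).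
  exact: Quotient.idealrBE.
split=> [h|/eqP h]; last by apply/tensor_nullP; rewrite E.
by apply/eqP; rewrite -E; apply/tensor_nullP.
Qed.

Lemma tensor_piK q : tensor_pi (repr q) = q.
Proof. exact: reprK. Qed.

Lemma tensor_piD s t : tensor_pi (s + t) = tensor_pi s + tensor_pi t.
Proof. by rewrite /tensor_pi; exact: Quotient.pi_add. Qed.

Definition tensor_scale (c : k) (q : tensor_sort) : tensor_sort :=
  tensor_pi (c *: repr q).

Lemma tensor_piZ c s : tensor_pi (c *: s) = tensor_scale c (tensor_pi s).
Proof.
apply/tensor_piP; rewrite -scalerBr; apply: TensorNullZ; apply/tensor_piP.
by rewrite tensor_piK.
Qed.

Lemma tensor_scaleA c d q :
  tensor_scale c (tensor_scale d q) = tensor_scale (c * d) q.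
Proof. by rewrite -(tensor_piK q) -!tensor_piZ scalerA. Qed.

Lemma tensor_scale1 : left_id 1 tensor_scale.
Proof. by move=> q; rewrite -(tensor_piK q) -!tensor_piZ scale1r. Qed.

Lemma tensor_scaleDr : right_distributive tensor_scale +%R.
Proof.
move=> c p q; rewrite -(tensor_piK p) -(tensor_piK q).
by rewrite -tensor_piD -!tensor_piZ scalerDr tensor_piD.
Qed.

Lemma tensor_scaleDl q : {morph tensor_scale^~ q : c d / c + d}.
Proof.
by move=> c d; rewrite -(tensor_piK q) -!tensor_piZ scalerDl tensor_piD.
Qed.

HB.instance Definition _ := GRing.Zmodule_isLmodule.Build k tensor_sort
  tensor_scaleA tensor_scale1 tensor_scaleDr tensor_scaleDl.

Lemma tensor_pi_linear : linear tensor_pi.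
Proof. by move=> c s t; rewrite tensor_piD tensor_piZ. Qed.
HB.instance Definition _ :=
  GRing.isLinear.Build k free tensor_sort *:%R tensor_pi tensor_pi_linear.

Definition pure (x : M) (y : N) : tensor_sort := tensor_pi << (x, y) >>.

Definition balanced (L : lmodType k) (f : M -> N -> L) : Prop :=
  [/\ forall x x' y, f (x + x') y = f x y + f x' y,
      forall x y y', f x (y + y') = f x y + f x y',
      forall (c : k) x y, f (c *: x) y = c *: f x y
    & forall x b y, f (ract x b) y = f x (lact b y)].

Lemma pure_balanced : balanced pure.
Proof.
split=> [x x' y|x y y'|c x y|x b y].
- apply/eqP; rewrite -subr_eq0 opprD addrA -!linearB; apply/eqP.
  by rewrite -[RHS](linear0 tensor_pi); apply/tensor_piP; rewrite subr0; exact: TensorDl.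
- apply/eqP; rewrite -subr_eq0 opprD addrA -!linearB; apply/eqP.
  by rewrite -[RHS](linear0 tensor_pi); apply/tensor_piP; rewrite subr0; exact: TensorDr.
- by rewrite /pure -linearZ; apply/tensor_piP; exact: TensorZ.
- by apply/tensor_piP; exact: TensorBal.
Qed.

Lemma tensor_linear_eq (L : lmodType k) (g h : {linear tensor_sort -> L}) :
  (forall x y, g (pure x y) = h (pure x y)) -> g =1 h.
Proof.
move=> gh q; rewrite -(tensor_piK q).
by apply: (freeg_linear_eq (f := g \o tensor_pi) (g := h \o tensor_pi)) => -[].
Qed.

Definition tensor_lift (L : lmodType k) (f : M -> N -> L) (q : tensor_sort) : L :=
  fglift (fun p : M * N => f p.1 p.2) (repr q).

Section Lift.
Variables (L : lmodType k) (f : M -> N -> L).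
Hypothesis bal_f : balanced f.

Lemma tensor_lift_pi s :
  tensor_lift f (tensor_pi s) = fglift (fun p : M * N => f p.1 p.2) s.
Proof.
have [fDl fDr fZ fB] := bal_f.
have fgU x : fglift (fun p : M * N => f p.1 p.2) << x >> = f x.1 x.2.
  by rewrite liftU scale1r.
apply/eqP; rewrite -subr_eq0 -linearB; apply/eqP.
have : tensor_null (repr (tensor_pi s) - s) by apply/tensor_piP/tensor_piK.
elim=> [x x' y|x y y'|c x y|x b y||t u _ IHt _ IHu|c t _ IHt].
- by rewrite !linearB /= !fgU /= fDl addrAC addrK subrr.
- by rewrite !linearB /= !fgU /= fDr addrAC addrK subrr.
- by rewrite linearB linearZ /= !fgU /= fZ subrr.
- by rewrite linearB /= !fgU /= fB subrr.
- by rewrite linear0.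
- by rewrite linearD /= IHt IHu addr0.
- by rewrite linearZ /= IHt scaler0.
Qed.

Lemma tensor_lift_pure x y : tensor_lift f (pure x y) = f x y.
Proof. by rewrite tensor_lift_pi liftU scale1r. Qed.

Lemma tensor_lift_linear : linear (tensor_lift f).
Proof.
move=> c p q; rewrite -(tensor_piK p) -(tensor_piK q).
by rewrite -linearP !tensor_lift_pi linearP.
Qed.

Lemma tensor_universal :
  exists2 g : {linear tensor_sort -> L}, (forall x y, g (pure x y) = f x y)
    & forall h : {linear tensor_sort -> L},
        (forall x y, h (pure x y) = f x y) -> h =1 g.
Proof.
pose g : {linear tensor_sort -> L} := HB.pack_for {linear tensor_sort -> L}
  (tensor_lift f) (GRing.isLinear.Build k tensor_sort L *:%R (tensor_lift f)
                     tensor_lift_linear).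
exists g => [|h hE]; first exact: tensor_lift_pure.
by apply: tensor_linear_eq => x y; rewrite hE -tensor_lift_pure.
Qed.

End Lift.

End Tensor.

Section TensorBimod.
Variables (k : fieldType) (U V W : finType) (M : bimod k U V) (N : bimod k V W).

Local Notation T := (tensor_sort M N).

Definition tensor_lact (a : {ffun U -> k^o}) : T -> T :=
  tensor_lift (fun x y => pure (lact a x) y).

Definition tensor_ract (q : T) (b : {ffun W -> k^o}) : T :=
  tensor_lift (fun x y => pure x (ract y b)) q.

Lemma tensor_lact_balanced a :
  balanced (fun (x : M) (y : N) => pure (lact a x) y).
Proof.
have [pDl pDr pZ pB] := pure_balanced M N; split=> [x x' y|x y y'|c x y|x b y].
- by rewrite lactDr pDl.
- exact: pDr.
- by rewrite lact_scaler pZ.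
- by rewrite -lractA pB.
Qed.

Lemma pure_scaler (c : k) (x : M) (y : N) : pure x (c *: y) = c *: pure x y.
Proof.
have [_ _ pZ pB] := pure_balanced M N; rewrite -pZ.
have -> : c *: y = lact (c *: (1 : {ffun V -> k^o})) y by rewrite lactZ lact1.
by rewrite -pB ractZ ract1.
Qed.

Lemma tensor_ract_balanced b :
  balanced (fun (x : M) (y : N) => pure x (ract y b)).
Proof.
have [pDl pDr pZ pB] := pure_balanced M N; split=> [x x' y|x y y'|c x y|x a y].
- exact: pDl.
- by rewrite ractDl pDr.
- exact: pZ.
- by rewrite pB lractA.
Qed.

HB.instance Definition _ a := GRing.isLinear.Build k T T *:%R (tensor_lact a)
  (tensor_lift_linear (tensor_lact_balanced a)).

Lemma tensor_ractP b : linear (tensor_ract^~ b).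
Proof. exact: (tensor_lift_linear (tensor_ract_balanced b)). Qed.

Lemma tensor_ractD p q b :
  tensor_ract (p + q) b = tensor_ract p b + tensor_ract q b.
Proof. by have := tensor_ractP b 1 p q; rewrite !scale1r. Qed.

Lemma tensor_ract0 b : tensor_ract 0 b = 0.
Proof. by apply: (addrI (tensor_ract 0 b)); rewrite -tensor_ractD !addr0. Qed.

Lemma tensor_lact_pure a x y : tensor_lact a (pure x y) = pure (lact a x) y.
Proof. exact: (tensor_lift_pure (tensor_lact_balanced a)). Qed.

Lemma tensor_ract_pure x y b : tensor_ract (pure x y) b = pure x (ract y b).
Proof. exact: (tensor_lift_pure (tensor_ract_balanced b)). Qed.

Lemma tensor_ind (P : T -> Prop) :
  P 0 -> (forall p q, P p -> P q -> P (p + q)) ->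
  (forall x y, P (pure x y)) -> forall q, P q.
Proof.
move=> P0 PD Pp q; rewrite -(tensor_piK q) -[repr q]freeg_sumE linear_sum.
apply: (big_ind P) => // -[x y] _.
set c := coeff _ _.
have -> : << c *g (x, y) >> = c *: << (x, y) >> :> {freeg (M * N)%type / k}.
  by apply/eqP/freeg_eqP => z; rewrite coeffZ !coeffU mul1r.
have [_ _ pZ _] := pure_balanced M N.
by rewrite linearZ -[X in P X]/(c *: pure x y) -pZ; apply: Pp.
Qed.

Definition tensor : bimod k U W.
Proof.
refine (@Bimod k U W T tensor_lact tensor_ract _ _ _ _ _ _ _ _ _ _ _).
- move=> a b; elim/tensor_ind => [|p q pE qE|x y].
  + by rewrite !linear0 addr0.
  + by rewrite !linearD /= pE qE addrACA.
  + by rewrite !tensor_lact_pure lactDl; case: (pure_balanced M N) => ->.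
- by move=> a p q; rewrite linearD.
- move=> c a; elim/tensor_ind => [|p q pE qE|x y].
  + by rewrite !linear0.
  + by rewrite !linearD /= pE qE.
  + by rewrite !tensor_lact_pure lactZ; case: (pure_balanced M N) => _ _ ->.
- elim/tensor_ind => [|p q pE qE|x y].
  + by rewrite linear0.
  + by rewrite linearD /= pE qE.
  + by rewrite tensor_lact_pure lact1.
- move=> a b; elim/tensor_ind => [|p q pE qE|x y].
  + by rewrite !linear0.
  + by rewrite !linearD /= pE qE.
  + by rewrite !tensor_lact_pure lactM.
- by move=> p q b; rewrite tensor_ractD.
- move=> q a b; elim/tensor_ind: q => [|p q pE qE|x y].
  + by rewrite !tensor_ract0 addr0.
  + by rewrite !tensor_ractD /= pE qE addrACA.
  + by rewrite !tensor_ract_pure ractDr; case: (pure_balanced M N) => _ ->.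
- move=> c q b; elim/tensor_ind: q => [|p q pE qE|x y].
  + by rewrite !tensor_ract0 scaler0.
  + by rewrite !tensor_ractD /= pE qE scalerDr.
  + by rewrite !tensor_ract_pure ractZ pure_scaler.
- elim/tensor_ind => [|p q pE qE|x y].
  + by rewrite tensor_ract0.
  + by rewrite tensor_ractD /= pE qE.
  + by rewrite tensor_ract_pure ract1.
- move=> q a b; elim/tensor_ind: q => [|p q pE qE|x y].
  + by rewrite !tensor_ract0.
  + by rewrite !tensor_ractD /= pE qE.
  + by rewrite !tensor_ract_pure ractM.
- move=> a q b; elim/tensor_ind: q => [|p q pE qE|x y].
  + by rewrite linear0 !tensor_ract0 linear0.
  + by rewrite linearD /= !tensor_ractD linearD /= pE qE.
  + by rewrite tensor_lact_pure !tensor_ract_pure tensor_lact_pure.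
Defined.

End TensorBimod.

Fixpoint tensor_pow (k : fieldType) (V : finType) (X : bimod k V V) (n : nat) :
  bimod k V V :=
  match n with
  | 0 => regular_bimod k V
  | 1 => X
  | m.+1 => tensor X (tensor_pow X m)
  end.

(* Main.v *)
From HB Require Import structures.
From mathcomp Require Import all_boot all_order all_algebra.
From mathcomp Require Import boolp.
Require Import Defs.

Set Implicit Arguments.
Unset Strict Implicit.
Unset Printing Implicit Defensive.

Import GRing.Theory.
Local Open Scope ring_scope.

(** Since kV and kW are products of copies of k, a bimodule M over them is the
    direct sum of its pieces vMw, and a finite-dimensional M is determined up
    to isomorphism by the nonnegative integer matrix of the dimensions of these
    pieces. Tensor products of bimodules correspond to products of matrices,
    because v(M (x) N)w is the direct sum over u of vMu (x) uNw. Under this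
    dictionary kE^1 has matrix A_E, and the four bimodule isomorphisms become
    the four equations of shift equivalence.

    The dictionary is set up with bigraphs, that is, finite sets of edges from
    V to W: a bigraph G spans a bimodule with basis its edges, M is presented
    by G when it is isomorphic to that bimodule, and bmatrix G counts edges.
    Lemma span_isoP says that the matrix is a complete invariant, and
    presents_tensor that composition of bigraphs presents the tensor product.
    One direction of the theorem is then immediate: realise R and S as
    bimodules.

    In the other direction M and N are arbitrary, and they have to be shown
    finite-dimensional. A vector x of M is recovered from the elements
    x (x) c of M (x) N as follows. Let p be a basis element of N (x) M with
    source w; there is one for each w because F has no sinks. Taking the
    coefficient at p of b (x) y defines, for each y in M, a linear map
      a (x) b |-> coef_p(b (x) y) a.w      from M (x) N to M,
    and if the sum of the c_j (x) y_j equals p, the images of the x (x) c_j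
    under the maps attached to the y_j add up to x.w. Since M (x) N is
    finite-dimensional, its elements are sums of pure tensors whose left
    factors a lie in one fixed finite list; hence the finitely many v.a.w span
    M (finite_spanning). A homogeneous finite spanning family contains a
    homogeneous basis (presents_of_spanning), which presents M by a bigraph.
    The same argument with the two graphs exchanged treats N. *)

(** * Isomorphisms of bimodules *)

Section BimodIso.
Variables (k : fieldType) (V W : finType).
Implicit Types M N P : bimod k V W.

Lemma bimod_iso_of_cancel M N (f : M -> N) (g : N -> M) :
  linear f -> cancel f g -> cancel g f ->
  (forall a x, f (lact a x) = lact a (f x)) ->
  (forall x b, f (ract x b) = ract (f x) b) -> bimod_iso M N.
Proof.
move=> lin_f fK gK fl fr.
pose F : {linear M -> N} := HB.pack_for {linear M -> N} f
  (GRing.isLinear.Build k M N *:%R f lin_f).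
by exists F; split=> //; exists g.
Qed.

Lemma bimod_iso_refl M : bimod_iso M M.
Proof. by apply: (@bimod_iso_of_cancel M M id id). Qed.

Lemma bimod_iso_sym M N : bimod_iso M N -> bimod_iso N M.
Proof.
case=> f [[g fK gK] fl fr].
apply: (@bimod_iso_of_cancel N M g f) => //; first exact: can2_linear fK gK.
- by move=> a x; rewrite -{1}(gK x) -fl fK.
- by move=> x b; rewrite -{1}(gK x) -fr fK.
Qed.

Lemma bimod_iso_trans M N P :
  bimod_iso M N -> bimod_iso N P -> bimod_iso M P.
Proof.
case=> f [[f' fK f'K] fl fr] [g [[g' gK g'K] gl gr]].
apply: (@bimod_iso_of_cancel M P (g \o f) (f' \o g')).
- by move=> c x y /=; rewrite !linearP.
- exact: can_comp.
- exact: can_comp.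
- by move=> a x /=; rewrite fl gl.
- by move=> x b /=; rewrite fr gr.
Qed.

End BimodIso.

(** * Bipartite graphs and their matrices *)

(** These play two roles at once: the edges are a basis for a bimodule, and the
    edge counts form a matrix that is not required to be square. *)
Record bigraph (V W : finType) := Bigraph {
  bedge : finType;
  bsrc : bedge -> V;
  brng : bedge -> W }.

Section Between.
Variables (V W : finType).
Implicit Types G H : bigraph V W.

Definition between G v w : {set bedge G} :=
  [set e | (bsrc e == v) && (brng e == w)].

Definition bmatrix G : 'M[nat]_(#|V|, #|W|) :=
  \matrix_(i, j) #|between G (enum_val i) (enum_val j)|.

Lemma eq_bmatrix G H :
  bmatrix G = bmatrix H <->
  forall v w, #|between G v w| = #|between H v w|.
Proof.
split=> [/matrixP GH v w|GH]; last by apply/matrixP=> i j; rewrite !mxE.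
by have := GH (enum_rank v) (enum_rank w); rewrite !mxE !enum_rankK.
Qed.

Definition graph_of_matrix (R : 'M[nat]_(#|V|, #|W|)) : bigraph V W :=
  @Bigraph V W {ij : 'I_#|V| * 'I_#|W| & 'I_(R ij.1 ij.2)}
    (fun e => enum_val (tag e).1) (fun e => enum_val (tag e).2).

Lemma bmatrix_of_matrix R : bmatrix (graph_of_matrix R) = R.
Proof.
apply/matrixP=> i j; rewrite mxE.
transitivity #|[set: 'I_(R i j)]|; last by rewrite cardsT card_ord.
pose T (ij : 'I_#|V| * 'I_#|W|) := 'I_(R ij.1 ij.2).
pose f (x : 'I_(R i j)) : bedge (graph_of_matrix R) := @Tagged _ (i, j) T x.
have f_inj : injective f.
  by move=> x y /eqP; rewrite /f eq_Tagged => /eqP.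
rewrite -(card_imset _ f_inj); apply: eq_card => -[[i' j'] x].
rewrite inE /= !(inj_eq enum_val_inj); apply/andP/imsetP.
  by case=> /eqP ii /eqP jj; subst i' j'; exists x; rewrite ?inE.
by case=> y _ /(congr1 tag) [-> ->]; rewrite !eqxx.
Qed.

End Between.

Definition comp_graph (U V W : finType) (G : bigraph U V) (H : bigraph V W) :
    bigraph U W :=
  @Bigraph U W {p : bedge G * bedge H | brng p.1 == bsrc p.2}
    (fun p => bsrc (val p).1) (fun p => brng (val p).2).

(** A path of length two is classified by its middle vertex, which is the
    summation index of the matrix product. *)
Lemma bmatrix_comp (U V W : finType) (G : bigraph U V) (H : bigraph V W) :
  bmatrix (comp_graph G H) = bmatrix G *m bmatrix H.
Proof.
apply/matrixP=> i j; rewrite !mxE; set u := enum_val i; set w := enum_val j.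
transitivity (\sum_(v : V) (#|between G u v| * #|between H v w|)%N).
  rewrite -sum1_card.
  rewrite (eq_bigl (fun p : bedge (comp_graph G H) =>
    (bsrc (val p).1 == u) && (brng (val p).2 == w))); last first.
    by move=> p; rewrite inE.
  rewrite -(big_sub_cond [pred p | brng p.1 == bsrc p.2]
    [pred p | (bsrc p.1 == u) && (brng p.2 == w)] (fun=> 1%N)).
  rewrite (partition_big (fun p => brng p.1) predT) //=.
  apply: eq_bigr => v _; rewrite -cardsX -sum1_card; apply: eq_bigl => -[e f].
  rewrite !inE /=; case: (eqVneq (brng e) v) => [->|_]; last by rewrite !andbF.
  by rewrite andbT [v == _]eq_sym; do 3!case: (_ == _).
rewrite (reindex (@enum_val V predT)) /=; last first.
  by exists enum_rank => x _; rewrite ?enum_rankK ?enum_valK.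
by apply: eq_bigr => l _; rewrite !mxE.
Qed.

(** * Bimodules with a homogeneous basis *)

Section Actions.
Variables (k : fieldType) (V W : finType) (M : bimod k V W).

Lemma fun_base_sum (X : finType) (c : {ffun X -> k^o}) :
  c = \sum_x c x *: fun_base k x.
Proof.
apply/ffunP=> y; rewrite sum_ffunE (bigD1 y) //= big1 => [|x xy].
  by rewrite !ffunE eqxx addr0 /= [RHS]mulr1.
by rewrite !ffunE eq_sym (negPf xy) scaler0.
Qed.

Lemma fun_one_sum (X : finType) :
  1 = \sum_x fun_base k x :> {ffun X -> k^o}.
Proof.
rewrite [LHS]fun_base_sum; apply: eq_bigr => x _.
by rewrite ffunE scale1r.
Qed.

Lemma mul_fun_base (X : finType) (a : {ffun X -> k^o}) x :
  a * fun_base k x = a x *: fun_base k x.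
Proof.
apply/ffunP=> y; rewrite !ffunE; case: eqP => [->|_] //=.
by rewrite mulr0 scaler0.
Qed.

Lemma fun_base_mul (X : finType) (a : {ffun X -> k^o}) x :
  fun_base k x * a = a x *: fun_base k x.
Proof. by rewrite -mul_fun_base; apply/ffunP=> y; rewrite !ffunE mulrC. Qed.

Lemma lact_sum (x : M) : x = \sum_v lact (fun_base k v) x.
Proof.
rewrite -[LHS]lact1 fun_one_sum.
elim/big_rec2: _ => [|v y a _ IH]; last by rewrite lactDl IH.
by rewrite -(scale0r (0 : {ffun V -> k^o})) lactZ scale0r.
Qed.

Lemma ract_sum (x : M) : x = \sum_w ract x (fun_base k w).
Proof.
rewrite -[LHS]ract1 fun_one_sum.
elim/big_rec2: _ => [|v y a _ IH]; last by rewrite ractDr IH.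
by rewrite -(scale0r (0 : {ffun W -> k^o})) ractZ scale0r.
Qed.

(** An element fixed by a basis idempotent v is killed by the others, so an
    algebra element acts on it through its value at v. *)
Lemma lact_homog a v (x : M) : lact (fun_base k v) x = x -> lact a x = a v *: x.
Proof. by move=> xE; rewrite -{1}xE -lactM mul_fun_base lactZ xE. Qed.

Lemma ract_homog b w (x : M) : ract x (fun_base k w) = x -> ract x b = b w *: x.
Proof. by move=> xE; rewrite -{1}xE -ractM fun_base_mul ractZ xE. Qed.

Lemma lact_linear a : linear (lact a : M -> M).
Proof. by move=> c x y; rewrite lactDr lact_scaler. Qed.

Lemma ract0 b : ract (0 : M) b = 0.
Proof. by rewrite -(scale0r (0 : M)) ract_scaler !scale0r. Qed.

HB.instance Definition _ a :=
  GRing.isLinear.Build k M M *:%R (lact a) (lact_linear a).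

End Actions.

Section SpanBimod.
Variables (k : fieldType) (V W : finType) (G : bigraph V W).

Definition span_lact (a : {ffun V -> k^o}) (x : {ffun bedge G -> k^o}) :
  {ffun bedge G -> k^o} := [ffun e => a (bsrc e) * x e].

Definition span_ract (x : {ffun bedge G -> k^o}) (b : {ffun W -> k^o}) :
  {ffun bedge G -> k^o} := [ffun e => x e * b (brng e)].

Definition span_bimod : bimod k V W.
Proof.
refine (@Bimod k V W {ffun bedge G -> k^o} span_lact span_ract
          _ _ _ _ _ _ _ _ _ _ _).
- by move=> a b x; apply/ffunP=> e; rewrite !ffunE mulrDl.
- by move=> a x y; apply/ffunP=> e; rewrite !ffunE mulrDr.
- by move=> c a x; apply/ffunP=> e; rewrite !ffunE /= scalerAl.
- by move=> x; apply/ffunP=> e; rewrite !ffunE mul1r.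
- by move=> a b x; apply/ffunP=> e; rewrite !ffunE mulrA.
- by move=> x y b; apply/ffunP=> e; rewrite !ffunE mulrDl.
- by move=> x a b; apply/ffunP=> e; rewrite !ffunE mulrDr.
- by move=> c x b; apply/ffunP=> e; rewrite !ffunE /= scalerAr.
- by move=> x; apply/ffunP=> e; rewrite !ffunE mulr1.
- by move=> x a b; apply/ffunP=> e; rewrite !ffunE mulrA.
- by move=> a x b; apply/ffunP=> e; rewrite !ffunE mulrA.
Defined.

Lemma span_lact_base (e : bedge G) :
  lact (fun_base k (bsrc e)) (fun_base k e : span_bimod) = fun_base k e.
Proof.
apply/ffunP=> f; rewrite !ffunE.
by case: (eqVneq f e) => [->|_]; rewrite ?eqxx ?mulr1 ?mulr0.
Qed.

Lemma span_ract_base (e : bedge G) :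
  ract (fun_base k e : span_bimod) (fun_base k (brng e)) = fun_base k e.
Proof.
apply/ffunP=> f; rewrite !ffunE.
by case: (eqVneq f e) => [->|_]; rewrite ?eqxx ?mul1r ?mul0r.
Qed.

End SpanBimod.

(** * The matrix is a complete invariant *)

Lemma card_leq_linear (k : fieldType) (A B : finType)
    (f : {linear {ffun A -> k^o} -> {ffun B -> k^o}}) :
  injective f -> (#|A| <= #|B|)%N.
Proof.
have dimE (X : finType) : dim {ffun X -> k^o} = #|X| by rewrite /dim /= muln1.
move=> f_inj; have kf : lker (linfun f) == 0%VS.
  by apply/lker0P => x y; rewrite !lfunE => /f_inj.
have /eqP kf0 : (fullv :&: lker (linfun f) == 0)%VS by rewrite (eqP kf) capv0.
have := dimvS (subvf (linfun f @: fullv)%VS).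
by rewrite (limg_dim_eq kf0) !dimvf !dimE.
Qed.

(** An isomorphism maps the piece v(-)w of one side injectively into that of
    the other, and the dimension of this piece is the number of edges from v
    to w. *)
Lemma span_iso_leq (k : fieldType) (V W : finType) (G H : bigraph V W) v w :
  bimod_iso (span_bimod k G) (span_bimod k H) ->
  (#|between G v w| <= #|between H v w|)%N.
Proof.
case=> f [/bij_inj f_inj fl fr].
pose A := {e | e \in between G v w}; pose B := {e | e \in between H v w}.
(* The pieces v(-)w are modelled as functions on the edges from v to w; they
   are reached by extension by zero and by restriction. *)
pose ext (c : {ffun A -> k^o}) : span_bimod k G :=
  [ffun e => if insub e is Some a then c a else 0].
pose res (x : span_bimod k H) : {ffun B -> k^o} := [ffun b => x (val b)].
have lin_g : linear (res \o f \o ext).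
  move=> c x y; have -> : (res \o f \o ext) (c *: x + y) =
      res (f (c *: ext x + ext y)).
    congr (res (f _)); apply/ffunP=> e; rewrite !ffunE.
    by case: insub => [a|]; rewrite ?ffunE // scaler0 addr0.
  by rewrite linearP; apply/ffunP=> b; rewrite !ffunE.
pose g : {linear {ffun A -> k^o} -> {ffun B -> k^o}} :=
  HB.pack_for {linear {ffun A -> k^o} -> {ffun B -> k^o}} (res \o f \o ext)
  (GRing.isLinear.Build k _ _ *:%R _ lin_g).
have ext_homog c :
    lact (fun_base k v) (ract (ext c) (fun_base k w)) = ext c.
  apply/ffunP=> e; rewrite !ffunE; case: insubP => [a|]; rewrite inE.
    by case/andP=> -> ->; rewrite mulr1 mul1r.
  by rewrite mul0r mulr0.
suff g_inj : injective g.
  by have := card_leq_linear g_inj; rewrite !card_sig.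
apply: raddf_inj => c gc0.
have fc0 : f (ext c) = 0.
  rewrite -ext_homog fl fr; apply/ffunP=> e; rewrite !ffunE.
  have [ein|] := boolP (e \in between H v w).
    have /ffunP/(_ (exist _ e ein)) := gc0; rewrite !ffunE /= => ->.
    by rewrite mul0r mulr0.
  by rewrite inE negb_and => /orP[]/negPf->; rewrite !(mul0r, mulr0).
have ext0 : ext c = 0 by apply: f_inj; rewrite fc0 linear0.
apply/ffunP=> a; have /ffunP/(_ (val a)) := ext0.
by rewrite !ffunE valK.
Qed.

(** Within each fibre, the element of index i is sent to the one of index i. *)
Lemma fiber_injection (A B T : finType) (f : A -> T) (g : B -> T) :
  (forall t, #|[pred a | f a == t]| <= #|[pred b | g b == t]|)%N ->
  exists2 h : A -> B, injective h & forall a, g (h a) = f a.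
Proof.
move=> le_fg; pose fibA t := enum [pred a | f a == t].
pose fibB t := enum [pred b | g b == t].
have szE t : (size (fibA t) <= size (fibB t))%N.
  by rewrite -!cardE; apply: le_fg.
have idx a : (index a (fibA (f a)) < size (fibB (f a)))%N.
  by apply: leq_trans (szE _); rewrite index_mem mem_enum inE.
have ex a : exists b, g b == f a.
  case E: (fibB (f a)) (idx a) => [|b s] // _; exists b.
  by have := mem_head b s; rewrite -E mem_enum inE.
pose d a := xchoose (ex a).
exists (fun a => nth (d a) (fibB (f a)) (index a (fibA (f a)))); last first.
  move=> a; have := mem_nth (d a) (idx a).
  by rewrite mem_enum => /eqP.
move=> a a' E.
have fE : f a = f a'.
  have := mem_nth (d a) (idx a); rewrite mem_enum => /eqP <-.
  by have := mem_nth (d a') (idx a'); rewrite mem_enum E => /eqP.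
move: E; rewrite (set_nth_default (d a') _ (idx a)) -fE => /eqP.
have idx' := idx a'; rewrite -fE in idx'.
rewrite nth_uniq ?enum_uniq // => /eqP.
apply: (@index_inj _ a (fibA (f a))).
all: by rewrite mem_enum inE ?fE.
Qed.

Lemma span_iso_of_card (k : fieldType) (V W : finType) (G H : bigraph V W) :
  (forall v w, #|between G v w| = #|between H v w|) ->
  bimod_iso (span_bimod k G) (span_bimod k H).
Proof.
move=> GH.
pose ends (K : bigraph V W) (e : bedge K) := (bsrc e, brng e).
have cardE (K : bigraph V W) t :
    #|[pred e | ends K e == t]| = #|between K t.1 t.2|.
  by apply: eq_card => e; rewrite !inE; case: t.
have [|h h_inj hE] := @fiber_injection _ _ _ (ends G) (ends H).
  by move=> t; rewrite !cardE GH.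
have [|h' h'_inj _] := @fiber_injection _ _ _ (ends H) (ends G).
  by move=> t; rewrite !cardE GH.
have [h1 hK h1K] := inj_card_bij h_inj (leq_card _ h'_inj).
apply: (@bimod_iso_of_cancel _ _ _ (span_bimod k G) (span_bimod k H)
  (fun x : {ffun bedge G -> k^o} => [ffun e => x (h1 e)])
  (fun y : {ffun bedge H -> k^o} => [ffun e => y (h e)])).
- by move=> c x y; apply/ffunP=> e; rewrite !ffunE.
- by move=> x; apply/ffunP=> e; rewrite !ffunE hK.
- by move=> x; apply/ffunP=> e; rewrite !ffunE h1K.
- move=> a x; apply/ffunP=> e; rewrite !ffunE.
  by have [<- _] := hE (h1 e); rewrite h1K.
- move=> x b; apply/ffunP=> e; rewrite !ffunE.
  by have [_ <-] := hE (h1 e); rewrite h1K.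
Qed.

Lemma span_isoP (k : fieldType) (V W : finType) (G H : bigraph V W) :
  bimod_iso (span_bimod k G) (span_bimod k H) <-> bmatrix G = bmatrix H.
Proof.
split=> [GH|/eq_bmatrix]; last exact: span_iso_of_card.
apply/eq_bmatrix => v w; apply/eqP; rewrite eqn_leq.
by rewrite (span_iso_leq _ _ GH) (span_iso_leq _ _ (bimod_iso_sym GH)).
Qed.

Definition presents (k : fieldType) (V W : finType) (M : bimod k V W)
    (G : bigraph V W) := bimod_iso M (span_bimod k G).

(** The dictionary between bimodules and matrices: for presented bimodules,
    being isomorphic is an equation between matrices. *)
Lemma presents_isoP (k : fieldType) (V W : finType) (M N : bimod k V W) G H :
  presents M G -> presents N H -> bimod_iso M N <-> bmatrix G = bmatrix H.
Proof.
move=> MG NH; rewrite -(span_isoP k); split=> [MN|GH].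
  exact: bimod_iso_trans (bimod_iso_sym MG) (bimod_iso_trans MN NH).
exact: bimod_iso_trans MG (bimod_iso_trans GH (bimod_iso_sym NH)).
Qed.

(** * Tensor products and composition of bigraphs *)

Section HomogBasis.
Variables (k : fieldType) (V W : finType) (M : bimod k V W) (G : bigraph V W).

(** The coordinate map f is carried along with the basis m, since the proofs
    below use single coordinates as linear functionals. *)
Definition homog_basis (f : M -> span_bimod k G) (m : bedge G -> M) :=
  [/\ forall e, f (m e) = fun_base k e,
      forall x, x = \sum_e f x e *: m e,
      forall e, lact (fun_base k (bsrc e)) (m e) = m e
    & forall e, ract (m e) (fun_base k (brng e)) = m e].

Lemma presents_basis : presents M G ->
  exists (f : {linear M -> span_bimod k G}) (m : bedge G -> M),
    [/\ bijective f, forall a x, f (lact a x) = lact a (f x),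
        forall x b, f (ract x b) = ract (f x) b & homog_basis f m].
Proof.
case=> f [[f' fK f'K] fl fr].
pose m e := f' (fun_base k e).
have fm e : f (m e) = fun_base k e by exact: f'K.
exists f, m; split=> //; first by exists f'.
split=> // [x|e|e]; apply: (can_inj fK).
- rewrite linear_sum [LHS]fun_base_sum; apply: eq_bigr => e _.
  by rewrite linearZ fm.
- by rewrite fl fm span_lact_base.
- by rewrite fr fm span_ract_base.
Qed.

End HomogBasis.

Section PresentsTensor.
Variables (k : fieldType) (U V W : finType).
Variables (M : bimod k U V) (N : bimod k V W).

Lemma pure0l (y : N) : pure (0 : M) y = 0.
Proof.
by have [_ _ pZ _] := pure_balanced M N; rewrite -(scale0r (0 : M)) pZ scale0r.
Qed.

Lemma pure0r (x : M) : pure x (0 : N) = 0.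
Proof. by rewrite -(scale0r (0 : N)) pure_scaler scale0r. Qed.

Lemma pure_suml (I : finType) (x : I -> M) (y : N) :
  pure (\sum_i x i) y = \sum_i pure (x i) y.
Proof.
have [pDl _ _ _] := pure_balanced M N.
by elim/big_rec2: _ => [|i q z _ <-]; [exact: pure0l | exact: pDl].
Qed.

Lemma pure_sumr (I : finType) (x : M) (y : I -> N) :
  pure x (\sum_i y i) = \sum_i pure x (y i).
Proof.
have [_ pDr _ _] := pure_balanced M N.
by elim/big_rec2: _ => [|i q z _ <-]; [exact: pure0r | exact: pDr].
Qed.

(** The tensors m_e (x) n_h with e and h composable form a basis; those with e
    and h not composable vanish, since m_e (x) n_h = m_e.w (x) n_h =
    m_e (x) w.n_h for w the range of e. *)
Lemma presents_tensor G H :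
  presents M G -> presents N H -> presents (tensor M N) (comp_graph G H).
Proof.
move=> /presents_basis[f [m [_ fl fr [fm fE _ mr]]]].
move=> /presents_basis[g [n [_ gl gr [gn gE nl _]]]].
have [pDl pDr pZ pB] := pure_balanced M N.
pose C := comp_graph G H.
pose phi (x : M) (y : N) : span_bimod k C :=
  [ffun p : bedge C => f x (val p).1 * g y (val p).2].
have bal : balanced phi.
  split=> [x x' y|x y y'|c x y|x b y]; apply/ffunP=> p; rewrite !ffunE.
  - by rewrite linearD ffunE mulrDl.
  - by rewrite linearD ffunE mulrDr.
  - by rewrite linearZ ffunE -scalerAl.
  - by rewrite fr gl !ffunE (eqP (valP p)) mulrA.
pose psi (c : span_bimod k C) : tensor M N :=
  \sum_(p : bedge C) c p *: (pure (m (val p).1) (n (val p).2) : tensor M N).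
pose Phi : tensor M N -> span_bimod k C := tensor_lift phi.
have Phi_pure x y : Phi (pure x y) = phi x y by exact: tensor_lift_pure.
have Phi_lin : linear Phi by exact: tensor_lift_linear.
pose PhiL : {linear tensor M N -> span_bimod k C} :=
  HB.pack_for {linear tensor M N -> span_bimod k C} Phi
  (GRing.isLinear.Build k _ _ *:%R _ Phi_lin).
have Phi0 : Phi 0 = 0 by exact: (linear0 PhiL).
have PhiD : {morph Phi : p q / p + q} by exact: (linearD PhiL).
have psi_lin : linear psi.
  move=> c x y; rewrite /psi scaler_sumr -big_split; apply: eq_bigr => p _.
  by rewrite !ffunE scalerDl scalerA.
pose psiL : {linear span_bimod k C -> tensor M N} :=
  HB.pack_for {linear span_bimod k C -> tensor M N} psi
  (GRing.isLinear.Build k _ _ *:%R _ psi_lin).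
apply: (@bimod_iso_of_cancel _ _ _ (tensor M N) (span_bimod k C) Phi psi) => //.
- apply: (@tensor_linear_eq _ _ _ _ M N (tensor M N)
           (psiL \o PhiL) idfun) => x y.
  rewrite -[LHS]/(psi (Phi (pure x y))) -[RHS]/(pure x y) Phi_pure.
  rewrite [in RHS](fE x) [in RHS](gE y) pure_suml.
  transitivity (\sum_e \sum_h
      (f x e * g y h) *: (pure (m e) (n h) : tensor M N)).
    rewrite pair_bigA /= /psi.
    rewrite (bigID (fun p => brng p.1 == bsrc p.2)) /= [X in _ + X]big1.
      rewrite addr0 (big_sub [pred p | brng p.1 == bsrc p.2]
        (fun p => (f x p.1 * g y p.2) *: (pure (m p.1) (n p.2) : tensor M N))).
      by apply: eq_bigr => p _; rewrite ffunE.
    (* The discarded terms are the pairs that are not composable. *)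
    move=> [e h] /= eh; rewrite -[m e]mr pB (lact_homog _ (nl h)) ffunE.
    by rewrite [bsrc h == _]eq_sym (negPf eh) scale0r pure0r scaler0.
  apply: eq_bigr => e _; rewrite pZ pure_sumr scaler_sumr.
  by apply: eq_bigr => h _; rewrite pure_scaler scalerA.
- move=> c; rewrite [RHS]fun_base_sum -[LHS]/(PhiL (psi c)) /psi linear_sum.
  apply: eq_bigr => p _; rewrite linearZ; congr (_ *: _).
  rewrite -[LHS]/(Phi _) Phi_pure; apply/ffunP=> q; rewrite !ffunE fm gn !ffunE.
  by rewrite -natrM mulnb -xpair_eqE -!surjective_pairing (inj_eq val_inj).
- move=> a; elim/tensor_ind => [|p q pE qE|x y].
  + by rewrite linear0 Phi0 linear0.
  + by rewrite linearD !PhiD pE qE linearD.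
  + rewrite -[lact a _]/(tensor_lact a _) tensor_lact_pure !Phi_pure.
    by apply/ffunP=> p; rewrite !ffunE fl ffunE mulrA.
- move=> q b; elim/tensor_ind: q => [|p q pE qE|x y].
  + by rewrite ract0 Phi0 ract0.
  + by rewrite ractDl !PhiD pE qE ractDl.
  + rewrite -[ract _ b]/(tensor_ract _ b) tensor_ract_pure !Phi_pure.
    by apply/ffunP=> p; rewrite !ffunE gr ffunE mulrA.
Qed.

End PresentsTensor.

(** Paths with n + 1 edges: starting from one edge avoids the need for a graph
    of empty paths. *)
Fixpoint path_graph (V : finType) (G : bigraph V V) (n : nat) : bigraph V V :=
  if n is n'.+1 then comp_graph G (path_graph G n') else G.

Lemma presents_pow (k : fieldType) (V : finType) (X : bimod k V V) G n :
  presents X G -> presents (tensor_pow X n.+1) (path_graph G n).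
Proof. by move=> XG; elim: n => //= n; apply: presents_tensor. Qed.

Lemma bmatrix_path (V : finType) (G : bigraph V V) n :
  bmatrix (path_graph G n) = bmatrix G ^+ n.+1.
Proof.
elim: n => [|n IH]; first by rewrite expr1.
by rewrite exprS -IH -mulmxE -bmatrix_comp.
Qed.

Definition edge_graph (E : finGraph) : bigraph (vert E) (vert E) :=
  Bigraph (@src E) (@rng E).

Lemma presents_edge (k : fieldType) (E : finGraph) :
  presents (edge_bimod k E) (edge_graph E).
Proof.
by apply: (@bimod_iso_of_cancel _ _ _ (edge_bimod k E)
  (span_bimod k (edge_graph E)) id id).
Qed.

Lemma path_src_surj (V : finType) (G : bigraph V V) n :
  (forall v, exists e : bedge G, bsrc e = v) ->
  forall v, exists p : bedge (path_graph G n), bsrc p = v.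
Proof.
move=> Gs; elim: n => // n IH v.
have [e ev] := Gs v; have [p pe] := IH (brng e).
have ep : brng e == bsrc p by rewrite pe.
by exists (exist _ (e, p) ep).
Qed.

(** * Finite generation *)

Definition is_subspace (k : fieldType) (L : lmodType k) (P : L -> Prop) :=
  [/\ P 0, forall x y, P x -> P y -> P (x + y) & forall c x, P x -> P (c *: x)].

Lemma subspace_sum (k : fieldType) (L : lmodType k) (P : L -> Prop)
    (I : Type) (r : seq I) (D : pred I) (x : I -> L) :
  is_subspace P -> (forall i, D i -> P (x i)) -> P (\sum_(i <- r | D i) x i).
Proof. by case=> P0 PD _ Px; apply: (big_ind P). Qed.

(** Phrased with subspaces rather than linear combinations, so that a family
    can be shown to span by checking closure properties, without sums. *)
Definition spanning (k : fieldType) (L : lmodType k) (I : Type) (x : I -> L) :=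
  forall P : L -> Prop, is_subspace P -> (forall i, P (x i)) -> forall y, P y.

(** A single tensor involves finitely many left factors. The conclusion is
    phrased with subspaces because it is applied to preimages of subspaces
    under linear maps. *)
Lemma tensor_left_factors (k : fieldType) (U V W : finType)
    (M : bimod k U V) (N : bimod k V W) (q : tensor M N) :
  exists l : seq M, forall P : tensor M N -> Prop, is_subspace P ->
    (forall x y, x \in l -> P (pure x y)) -> P q.
Proof.
elim/tensor_ind: q => [|p q [l1 Hp] [l2 Hq]|x y].
- by exists [::] => P [].
- exists (l1 ++ l2) => P PS Pl; have [_ PD _] := PS.
  apply: PD; [apply: Hp | apply: Hq] => // x y xl.
    by apply: Pl; rewrite mem_cat xl.
  by apply: Pl; rewrite mem_cat xl orbT.
- by exists [:: x] => P _; apply; rewrite mem_head.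
Qed.

(** When the tensor product is finite-dimensional, the left factors of its
    basis elements serve for all tensors. *)
Lemma tensor_finite_left_factors (k : fieldType) (U V W : finType)
    (M : bimod k U V) (N : bimod k V W) (G : bigraph U W) :
  presents (tensor M N) G ->
  exists l : seq M, forall P : tensor M N -> Prop, is_subspace P ->
    (forall x y, x \in l -> P (pure x y)) -> forall q, P q.
Proof.
case/presents_basis=> f [m [_ _ _ [_ fE _ _]]].
have [L HL] := choice (fun e => tensor_left_factors (m e)).
exists (flatten [seq L e | e <- enum (bedge G)]) => P PS Pl q.
rewrite (fE q); apply: subspace_sum => // e _; have [_ _ PZ] := PS.
apply: PZ; apply: HL => // x y xL; apply: Pl; apply/flattenP.
by exists (L e) => //; apply: map_f; rewrite mem_enum.
Qed.

Section FiniteGeneration.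
Variables (k : fieldType) (V W : finType).
Variables (M : bimod k V W) (N : bimod k W V).
Variables (G : bigraph V V) (H : bigraph W W).
Hypothesis MN_G : presents (tensor M N) G.
Hypothesis NM_H : presents (tensor N M) H.
Hypothesis H_src : forall w, exists p : bedge H, bsrc p = w.

(** The only place where the absence of sinks matters: for w without an edge p
    of H starting there, N could vanish on the left at w and then the tensor
    products would put no constraint on M.w. *)
Lemma finite_spanning :
  exists (K : bigraph V W) (m : bedge K -> M),
    [/\ spanning m,
        forall e, lact (fun_base k (bsrc e)) (m e) = m e
      & forall e, ract (m e) (fun_base k (brng e)) = m e].
Proof.
have [l Hl] := tensor_finite_left_factors MN_G.
pose K := @Bigraph V W (seq_sub l * V * W)%type
  (fun i => i.1.2) (fun i => i.2).
pose m (e : bedge K) : M :=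
  ract (lact (fun_base k (bsrc e)) (ssval e.1.1)) (fun_base k (brng e)).
have baseK (X : finType) (x : X) :
    fun_base k x * fun_base k x = fun_base k x.
  by rewrite fun_baseM eqxx scale1r.
exists K, m; split=> [P PS Pm x|e|e]; last 2 first.
- by rewrite /m -lractA -lactM baseK.
- by rewrite /m -ractM baseK.
have Pl a w : a \in l -> P (ract a (fun_base k w)).
  move=> al; rewrite (lact_sum (ract a _)); apply: subspace_sum => // v _.
  by rewrite -lractA; apply: (Pm (SeqSub al, v, w)).
rewrite (ract_sum x); apply: subspace_sum => // w _.
have [p pw] := H_src w.
have [f [n [_ fl _ [fn _ _ _]]]] := presents_basis NM_H.
have [P0 PD PZ] := PS.
(* The coordinate at p is balanced against the idempotent w = bsrc p. It is
   enough to let z run over pure tensors b (x) y; for these the vector in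
   question is the image of x (x) b under the map g below. *)
suff Pf z : P (f z p *: ract x (fun_base k w)).
  by have := Pf (n p); rewrite fn ffunE eqxx scale1r.
elim/tensor_ind: z => [|z z' Pz Pz'|b y].
- by rewrite linear0 ffunE scale0r.
- by rewrite linearD ffunE scalerDl; apply: PD.
pose g (a : M) (c : N) := f (pure c y) p *: ract a (fun_base k w).
have [nDl _ nZ _] := pure_balanced N M.
have bal_g : balanced g.
  split=> [a a' c|a c c'|c a d|a s c].
  - by rewrite /g ractDl scalerDr.
  - by rewrite /g nDl linearD ffunE scalerDl.
  - by rewrite /g ract_scaler !scalerA mulrC.
  - rewrite /g -ractM mul_fun_base ractZ scalerA; congr (_ *: _).
    rewrite -tensor_lact_pure.
    rewrite -[tensor_lact s _]/(lact s (pure c y : tensor N M)).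
    by rewrite fl ffunE pw mulrC.
have [gL gLE _] := tensor_universal bal_g.
have QS : is_subspace (fun q : tensor M N => P (gL q)).
  split=> [|q q' Pq Pq'|c q Pq]; first by rewrite linear0.
    by rewrite linearD; apply: PD.
  by rewrite linearZ; apply: PZ.
have := Hl _ QS _ (pure x b); rewrite gLE; apply=> a c al.
by rewrite gLE; apply: PZ; apply: Pl.
Qed.

End FiniteGeneration.

(** Induction on the number of generators: a generator with a nonzero
    coefficient in some linear relation can be dropped, and when there is no
    relation the generators form a basis. Homogeneity passes to subfamilies. *)
Lemma presents_of_spanning (k : fieldType) (V W : finType) (M : bimod k V W)
    (K : bigraph V W) (m : bedge K -> M) :
  spanning m ->
  (forall e, lact (fun_base k (bsrc e)) (m e) = m e) ->
  (forall e, ract (m e) (fun_base k (brng e)) = m e) ->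
  exists G : bigraph V W, presents M G.
Proof.
have [n] := ubnP #|bedge K|; elim: n => // n IH in K m *.
rewrite ltnS => leKn span_m ml mr.
pose comb (c : span_bimod k K) : M := \sum_e c e *: m e.
have comb_lin : linear comb.
  move=> c x y; rewrite /comb scaler_sumr -big_split; apply: eq_bigr => e _.
  by rewrite !ffunE scalerDl scalerA.
pose combL : {linear span_bimod k K -> M} :=
  HB.pack_for {linear span_bimod k K -> M} comb
  (GRing.isLinear.Build k _ _ *:%R _ comb_lin).
have [[c [comb0 c0]]|indep] :=
    pselect (exists c : span_bimod k K, comb c = 0 /\ c <> 0).
  have [e ce] : exists e, c e != 0.
    apply/existsP; apply: contra_notT c0; rewrite negb_exists => /forallP c0.
    by apply/ffunP=> e; rewrite ffunE; apply/eqP; have := c0 e; rewrite negbK.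
  pose K' := @Bigraph V W {e' | e' != e}
    (fun e' => bsrc (val e')) (fun e' => brng (val e')).
  apply: (IH K' (fun e' => m (val e'))) => [|P PS Pm|e'|e']; last 2 first.
  - exact: ml.
  - exact: mr.
  - apply: leq_trans leKn; rewrite [X in (X < _)%N](_ : _ = #|bedge K|.-1).
      by rewrite ltn_predL; apply/card_gt0P; exists e.
    by rewrite card_sig -(cardC1 e); apply: eq_card => i; rewrite !inE.
  have [_ _ PZ] := PS.
  have Pne e' : e' != e -> P (m e') by move=> e'e; apply: (Pm (exist _ e' e'e)).
  apply: span_m => // e'; have [->|] := eqVneq e' e; last exact: Pne.
  have -> : m e = - (c e)^-1 *: \sum_(i | i != e) c i *: m i.
    move: comb0; rewrite /comb (bigD1 e) //= => /eqP; rewrite addr_eq0 => /eqP.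
    move/(congr1 (fun x => (c e)^-1 *: x)); rewrite scalerA mulVf // scale1r.
    by rewrite scalerN scaleNr.
  by apply: (PZ); apply: subspace_sum => // i ie; apply: PZ; apply: Pne.
have comb_inj : injective comb.
  apply: (@raddf_inj _ _ combL) => c c0.
  by apply: contrapT => cn0; apply: indep; exists c.
have comb_surj x : exists c, comb c = x.
  apply: (span_m (fun y => exists c, comb c = y)) => [|e].
    split=> [|y z [c <-] [d <-]|a y [c <-]].
    - by exists 0; apply: (linear0 combL).
    - by exists (c + d); apply: (linearD combL).
    - by exists (a *: c); apply: (linearZZ combL).
  exists (fun_base k e); rewrite /comb (bigD1 e) //= ffunE eqxx scale1r.
  by rewrite big1 ?addr0 // => i ie; rewrite ffunE (negPf ie) scale0r.
have [coef coefK] := choice comb_surj.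
exists K; apply: bimod_iso_sym.
apply: (@bimod_iso_of_cancel _ _ _ (span_bimod k K) M comb coef) => //.
- by move=> c; apply: comb_inj; rewrite coefK.
- move=> a c; rewrite /comb (linear_sum (lact a)); apply: eq_bigr => e _.
  by rewrite linearZ /= (lact_homog _ (ml e)) ffunE scalerA mulrC.
- move=> c b; rewrite /comb; elim/big_rec2: _ => [|e y z _ IHz].
    by rewrite ract0.
  by rewrite ractDl -IHz ract_scaler (ract_homog _ (mr e)) ffunE scalerA.
Qed.

(** An arbitrary factor M of finite-dimensional tensor products is itself given
    by a bigraph. *)
Lemma presents_factor (k : fieldType) (V W : finType)
    (M : bimod k V W) (N : bimod k W V) (G : bigraph V V) (H : bigraph W W) :
  presents (tensor M N) G -> presents (tensor N M) H ->
  (forall w, exists p : bedge H, bsrc p = w) ->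
  exists K : bigraph V W, presents M K.
Proof.
move=> MN NM Hs; have [K [m [sm ml mr]]] := finite_spanning MN NM Hs.
exact: presents_of_spanning sm ml mr.
Qed.

Lemma edge_src_surj (E : finGraph) : no_sinks E ->
  forall v, exists e : bedge (edge_graph E), bsrc e = v.
Proof.
by move=> hE v; case/set0Pn: (hE v) => e; rewrite inE => /eqP; exists e.
Qed.

Theorem theorem3p9 (k : fieldType) (E F : finGraph)
    (hE : no_sinks E) (hF : no_sinks F) :
  shift_equivalent (adjacency E) (adjacency F) <->
  exists (M : bimod k (vert E) (vert F)) (N : bimod k (vert F) (vert E))
      (n : nat),
    (0 < n)%N /\
    [/\ bimod_iso (tensor_pow (edge_bimod k E) n) (tensor M N),
        bimod_iso (tensor_pow (edge_bimod k F) n) (tensor N M),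
        bimod_iso (tensor (edge_bimod k E) M) (tensor M (edge_bimod k F))
      & bimod_iso (tensor (edge_bimod k F) N) (tensor N (edge_bimod k E))].
Proof.
have pE := presents_edge k E; have pF := presents_edge k F.
rewrite -[adjacency E]/(bmatrix (edge_graph E)).
rewrite -[adjacency F]/(bmatrix (edge_graph F)).
have isoP (M : bimod k (vert E) (vert F)) (N : bimod k (vert F) (vert E))
    G H n :
    presents M G -> presents N H ->
    [/\ bimod_iso (tensor_pow (edge_bimod k E) n.+1) (tensor M N),
        bimod_iso (tensor_pow (edge_bimod k F) n.+1) (tensor N M),
        bimod_iso (tensor (edge_bimod k E) M) (tensor M (edge_bimod k F))
      & bimod_iso (tensor (edge_bimod k F) N) (tensor N (edge_bimod k E))] <->
    [/\ bmatrix (edge_graph E) ^+ n.+1 = bmatrix G *m bmatrix H,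
        bmatrix (edge_graph F) ^+ n.+1 = bmatrix H *m bmatrix G,
        bmatrix (edge_graph E) *m bmatrix G =
          bmatrix G *m bmatrix (edge_graph F)
      & bmatrix (edge_graph F) *m bmatrix H =
          bmatrix H *m bmatrix (edge_graph E)].
  move=> MG NH; rewrite -!bmatrix_path -!bmatrix_comp.
  have [XE XF] := (presents_pow n pE, presents_pow n pF).
  have MN := presents_tensor MG NH; have NM := presents_tensor NH MG.
  have EM := presents_tensor pE MG; have MF := presents_tensor MG pF.
  have FN := presents_tensor pF NH; have NE := presents_tensor NH pE.
  have [[a a'] [b b']] := (presents_isoP XE MN, presents_isoP XF NM).
  have [[c c'] [d d']] := (presents_isoP EM MF, presents_isoP FN NE).
  by split=> [[/a ? /b ? /c ? /d ?]|[/a' ? /b' ? /c' ? /d' ?]].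
split=> [[n [R [S [n0 eqs]]]]|[M [N [n [n0 isos]]]]].
  exists (span_bimod k (graph_of_matrix R)).
  exists (span_bimod k (graph_of_matrix S)), n.
  split=> //; case: n n0 eqs => // n _ eqs.
  have /isoP d := bimod_iso_refl (span_bimod k (graph_of_matrix R)).
  by apply/(d _ _ n (bimod_iso_refl _)); rewrite !bmatrix_of_matrix.
case: n n0 isos => // n _ isos; have [i1 i2 _ _] := isos.
have MN := bimod_iso_trans (bimod_iso_sym i1) (presents_pow n pE).
have NM := bimod_iso_trans (bimod_iso_sym i2) (presents_pow n pF).
have [G MG] := presents_factor MN NM (path_src_surj n (edge_src_surj hF)).
have [H NH] := presents_factor NM MN (path_src_surj n (edge_src_surj hE)).
exists n.+1, (bmatrix G), (bmatrix H).
by split=> //; apply/(isoP M N G H n MG NH).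
Qed.
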